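(* For every integer $\Delta \geq 0$ and every integer $k \geq 2$: (1) $g(0,k) = 0$. (2) $g(1,k) = \lfloor \frac{k-1}{2} \rfloor$. (3) For $\Delta \geq 1$, $g(\Delta,2) = \left\lceil \frac{-3 + \sqrt{8\Delta + 1}}{2} \right\rceil$.
   Context: All graphs are finite and simple. For a graph $G$ and an integer $k \geq 2$, $f_k(G)$ denotes the minimum number of vertices that must be deleted from $G$ to obtain an induced subgraph $H$ in which at least $k$ vertices have degree $\Delta(H)$ (the maximum degree of $H$), or otherwise $|H| < k$, where $|H|$ is the number of vertices of $H$. For integers $\Delta \geq 0$ and $k \geq 2$, $g(\Delta,k) = \max\{ f_k(G) : \Delta(G) \leq \Delta\}$, the maximum being over all graphs $G$ with maximum degree at most $\Delta$. *)

(* Defs.v *)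
From HB Require Import structures.
From mathcomp Require Import all_boot all_order all_algebra.
From mathcomp Require Import reals.

Set Implicit Arguments.
Unset Strict Implicit.
Unset Printing Implicit Defensive.

(* The vertex type may be empty; the empty graph has maximum degree 0. *)
Record sgraph := SGraph {
  vertex :> finType;
  adj : rel vertex;
  adj_sym : symmetric adj;
  adj_irr : irreflexive adj }.

Definition deg (G : sgraph) (x : G) : nat := #|[set y : G | adj x y]|.

Definition maxdeg (G : sgraph) : nat := \max_(x : G) deg x.

Section Induced.
Variables (G : sgraph) (A : {set G}).

Definition induced_adj : rel {x : G | x \in A} :=
  fun x y => adj (val x) (val y).

Lemma induced_adj_sym : symmetric induced_adj.
Proof. by move=> x y; apply: adj_sym. Qed.

Lemma induced_adj_irr : irreflexive induced_adj.
Proof. by move=> x; apply: adj_irr. Qed.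

Definition induced : sgraph := SGraph induced_adj_sym induced_adj_irr.
End Induced.

Definition equated (k : nat) (H : sgraph) : bool :=
  (k <= #|[set x : H | deg x == maxdeg H]|) || (#|H| < k).

Definition deletable (k : nat) (G : sgraph) (S : {set G}) : bool :=
  equated k (induced (~: S)).

(* The default [set: G] of the arg min is itself deletable, since deleting
   every vertex leaves the empty graph: see deletable_setT. *)
Definition fk (k : nat) (G : sgraph) : nat :=
  #|[arg min_(S < [set: G] | deletable k S) #|S| ]|.

Lemma deletable_setT (k : nat) (G : sgraph) : deletable k [set: G].
Proof.
rewrite /deletable /equated orbC.
have -> : #|induced (~: [set: G])| = 0.
  by apply: eq_card0 => -[x xA]; exfalso; rewrite !inE in xA.
by case: k.
Qed.

(* The maximum is over infinitely many graphs, so g is a relation rather than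
   a function: is_g Delta k m means that the maximum exists and equals m. *)
Definition is_g (Delta k m : nat) : Prop :=
  (exists G : sgraph, maxdeg G <= Delta /\ fk k G = m) /\
  (forall G : sgraph, maxdeg G <= Delta -> fk k G <= m).

(* Main.v *)
Require Import Defs.
From mathcomp Require Import all_boot all_order all_algebra.
From mathcomp Require Import reals.
From mathcomp Require Import zify lra.

Set Implicit Arguments.
Unset Strict Implicit.
Unset Printing Implicit Defensive.

Import GRing.Theory Num.Theory.

(** Let T(n) = 'C(n, 2) denote the triangular numbers. The formula in (3) is
    a closed form of the unique m with T(m+1) < Delta <= T(m+2)
    ([ceil_triangular]), because (2n+1)^2 = 8 T(n+1) + 1; so (3) amounts to two
    combinatorial bounds.

    Upper bound in (3), [equate2]. Let x have the largest degree and y the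
    second largest. At least deg x - deg y neighbours of x are neither y nor
    neighbours of y ([card_private_nbrs]), and deleting exactly that many brings
    x down to the degree of y without touching y, so x and y become tied at the
    top ([level_top_degrees]). If this costs more than m, then
    deg y <= T(m+2) - (m+1) = T(m+1), and deleting x alone leaves a graph with
    maximum degree at most T(m+1), to which induction on m applies.

    Lower bound in (3), [deletable_triangular_stars]. Take disjoint stars of
    sizes T(i+2) + 1 for i < m. After fewer than m deletions some centre
    survives; let i be the largest surviving one. The centres above i took
    m - 1 - i of the deletions, so star i lost at most i leaves, and the gap
    T(i+2) - T(i+1) = i + 1 keeps its centre strictly above everything else.

    For (2) a graph of maximum degree at most 1 is a matching plus isolated
    vertices. If fewer than k vertices are matched, deleting one end of each
    edge makes all degrees 0 ([edgeless_matching]). Conversely a matching with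
    floor((k-1)/2) edges and plenty of isolated vertices has fewer than k
    vertices of degree 1, so every edge has to be hit ([deletable_matching]).
    Both extremal examples are instances of [star_forest].

    Vertex deletions are iterated in the upper bounds, so everything is phrased
    with vertex subsets of one fixed graph and the degrees they induce, rather
    than with induced subgraphs of induced subgraphs. *)

(** * Degrees inside a vertex subset *)

Section Induced.
Variable G : sgraph.
Implicit Types (A B S T : {set G}) (x y : G).

Definition nbrs A x : {set G} := [set y in A | adj x y].

Definition degin A x : nat := #|nbrs A x|.

Lemma nbrsS A B x : B \subset A -> nbrs B x \subset nbrs A x.
Proof.
move=> sBA; apply/subsetP=> y; rewrite !inE => /andP[yB ->].
by rewrite (subsetP sBA).
Qed.

Lemma deginS A B x : B \subset A -> degin B x <= degin A x.
Proof. by move=> /nbrsS sBA; apply: subset_leq_card. Qed.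

Lemma deg_induced A (x : induced A) : deg x = degin A (val x).
Proof.
rewrite /deg /degin -(card_imset _ val_inj).
apply: eq_card => y; rewrite !inE; apply/imsetP/andP.
  by case=> z; rewrite inE => xz ->; split; first exact: (valP z).
by case=> yA xy; exists (Sub y yA); rewrite ?inE.
Qed.

Lemma maxdegE : maxdeg G = \max_x degin setT x.
Proof. by apply: eq_bigr => x _; apply: eq_card => y; rewrite !inE. Qed.

(** Exhibiting one vertex that attains the bound [d] identifies [d] as the
    maximum degree; this is how equatedness is decided everywhere below. *)
Lemma equated_induced k d A x : x \in A -> degin A x = d ->
    (forall y, y \in A -> degin A y <= d) ->
  equated k (induced A) = (k <= #|[set y in A | degin A y == d]|) || (#|A| < k).
Proof.
move=> xA dx dmax; rewrite /equated.
have -> : maxdeg (induced A) = d.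
  apply/eqP; rewrite eqn_leq; apply/andP; split.
    by apply/bigmax_leqP=> y _; rewrite deg_induced dmax ?(valP y).
  by rewrite -dx -[x]/(val (Sub x xA : induced A)) -deg_induced leq_bigmax.
have -> : #|induced A| = #|A| by rewrite card_sig; apply: eq_card.
congr ((_ <= _) || _).
rewrite -(card_imset _ val_inj); apply: eq_card => y.
rewrite !inE; apply/imsetP/andP.
  case=> z; rewrite inE deg_induced => dz ->.
  by split; first exact: (valP z).
by case=> yA dy; exists (Sub y yA); rewrite ?inE ?deg_induced.
Qed.

Lemma equated_small k A : #|A| < k -> equated k (induced A).
Proof.
move=> Ak; rewrite /equated orbC card_sig.
by rewrite (@eq_card _ _ (mem A)) ?Ak.
Qed.

Lemma equated_edgeless k A : 
  (forall x, x \in A -> degin A x = 0) -> equated k (induced A).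
Proof.
move=> A0; have [->|[x xA]] := set_0Vmem A.
  by case: k => [|k]; [|apply: equated_small; rewrite cards0].
rewrite (equated_induced k xA (A0 x xA)) => [|y /A0 -> //].
suff -> : [set y in A | degin A y == 0] = A by rewrite leqNgt orNb.
by apply/setP=> y; rewrite inE andb_idr // => /A0 ->.
Qed.

Lemma equated2 A x y : x \in A -> y \in A -> x != y ->
    degin A y = degin A x -> (forall z, z \in A -> degin A z <= degin A x) ->
  equated 2 (induced A).
Proof.
move=> xA yA xy dxy dmax.
rewrite (equated_induced 2 xA (erefl _) dmax); apply/orP; left.
have <- : #|[set x; y]| = 2 by rewrite cards2 xy.
apply/subset_leq_card/subsetP=> z /set2P[] ->; rewrite inE.
  by rewrite xA eqxx.
by rewrite yA dxy eqxx.
Qed.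

Lemma fk_le k S : deletable k S -> fk k G <= #|S|.
Proof.
move=> dS; rewrite /fk.
by case: arg_minnP => [|T _ minT]; [apply: deletable_setT | apply: minT].
Qed.

Lemma fk_ge k n :
  (forall S, deletable k S -> n <= #|S|) -> n <= fk k G.
Proof.
move=> H; rewrite /fk.
by case: arg_minnP => [|T dT _]; [apply: deletable_setT | apply: H].
Qed.

Lemma fk_le_induced k t :
  (exists2 B : {set G}, #|setT :\: B| <= t & equated k (induced B)) ->
  fk k G <= t.
Proof.
case=> B; rewrite setTD => Bt eB; apply: leq_trans Bt; apply: fk_le.
by rewrite /deletable setCK.
Qed.
End Induced.

(** * Upper bounds *)

Lemma subset_of_card (T : finType) (D : {set T}) n :
  n <= #|D| -> exists2 E : {set T}, E \subset D & #|E| = n.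
Proof.
move=> nD; exists [set z in take n (enum D)].
  by apply/subsetP=> z; rewrite inE => /mem_take; rewrite mem_enum.
rewrite cardsE (card_uniqP _) ?take_uniq ?enum_uniq //.
by rewrite size_takel // -cardE.
Qed.

Lemma card_setD_trans (T : finType) (A B C : {set T}) :
  #|A :\: C| <= #|A :\: B| + #|B :\: C|.
Proof.
apply: leq_trans (leq_card_setU _ _); apply/subset_leq_card/subsetP=> z.
by rewrite !inE; case: (z \in A); case: (z \in B); case: (z \in C).
Qed.

Section UpperBounds.
Variable G : sgraph.
Implicit Types (A B C : {set G}) (x y z : G).

Lemma degin_del A x y : x \in A -> adj x y -> degin (A :\ x) y < degin A y.
Proof.
move=> xA xy; apply/proper_card/properP; split.
  exact/nbrsS/subsetDl.
by exists x; rewrite !inE ?xA ?eqxx // adj_sym.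
Qed.

Lemma card_del_trans t A C x :
  #|(A :\ x) :\: C| <= t -> #|A :\: C| <= t.+1.
Proof.
move=> cC; apply: leq_trans (card_setD_trans A (A :\ x) C) _.
rewrite -add1n leq_add // setDDr setDv set0U.
by apply: leq_trans (subset_leq_card (subsetIr _ _)) _; rewrite cards1.
Qed.

Lemma edgeless_or_edge A :
  (forall x, x \in A -> degin A x = 0) \/
  (exists x y, [/\ x \in A, y \in A & adj x y]).
Proof.
have [A0|] := boolP [forall x in A, degin A x == 0].
  by left=> x /(forall_inP A0)/eqP.
rewrite negb_forall_in => /exists_inP[x xA]; rewrite -lt0n => /card_gt0P[y].
by rewrite inE => /andP[yA xy]; right; exists x, y.
Qed.

(** An edge has both ends among the vertices of degree 1, and deleting one end
    isolates the other: each deletion therefore removes two such vertices. *)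
Lemma edgeless_matching t A :
    (forall x, x \in A -> degin A x <= 1) ->
    #|[set x in A | degin A x == 1]| <= t.*2.+1 ->
  exists2 B, #|A :\: B| <= t & forall x, x \in B -> degin B x = 0.
Proof.
(* The two cases with an edge share the facts on its ends; for t = 0 these
   already contradict the bound on the vertices of degree 1. *)
elim: t A => [|t IH] A A1 cA; have [A0|[x [y [xA yA xy]]]] := edgeless_or_edge A.
1,3: by exists A; rewrite ?setDv ?cards0.
all: have D1 z w : z \in A -> w \in A -> adj z w -> degin A z == 1
  by move=> zA wA zw; rewrite eqn_leq A1 //; apply/card_gt0P; exists w; rewrite inE wA.
all: have yx : y != x by apply: contraTneq xy => ->; rewrite adj_irr.
all: have yx1 : y \in [set z in A | degin A z == 1] :\ x
  by rewrite !inE yx yA (D1 y x) // adj_sym.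
all: move: cA; rewrite (cardsD1 x) inE xA (D1 x y) // (cardsD1 y (_ :\ x)) yx1 //.
rewrite !add1n doubleS !ltnS => cA.
have sA := subsetDl A [set x].
have [z /(subsetP sA) zA||C cC C0] := IH (A :\ x).
- by apply: leq_trans (deginS z sA) (A1 z zA).
- apply: leq_trans cA; apply/subset_leq_card/subsetP=> z; rewrite !inE.
  case/andP=> /andP[zx zA] dz; rewrite zx zA /=.
  have dAz := deginS z sA; rewrite (eqP dz) in dAz.
  rewrite eqn_leq A1 // dAz !andbT.
  apply: contraTneq dz => ->; rewrite neq_ltn.
  by rewrite (leq_trans (degin_del xA xy)) ?A1.
by exists C; first exact: card_del_trans cC.
Qed.

(** Excluding [y] costs 1 exactly when [x] and [y] are adjacent, and then [x]
    is a neighbour of [y] that is not common to both, which pays it back. *)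
Lemma card_private_nbrs A x y : x \in A -> y \in A ->
  degin A x - degin A y <= #|(nbrs A x :\ y) :\: nbrs A y|.
Proof.
move=> xA yA; rewrite /degin.
rewrite (cardsD1 y (nbrs A x)) (cardsD1 x (nbrs A y)) !inE xA yA /=.
rewrite [adj y x]adj_sym subnDl [leqRHS]cardsD; apply: leq_sub2l.
apply/subset_leq_card/subsetP=> z; rewrite !inE.
case/andP=> /and3P[zy zA xz] /andP[_ ->]; rewrite zA !andbT.
by apply/eqP=> zx; rewrite zx adj_irr in xz.
Qed.

(** Delete just enough private neighbours of [x]: the degree of [y] is
    unaffected and no other degree grows, so [x] and [y] tie for the maximum. *)
Lemma level_top_degrees A x y : x \in A -> y \in A -> x != y ->
    degin A y <= degin A x ->
    (forall z, z \in A -> z != x -> degin A z <= degin A y) ->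
  exists2 B, #|A :\: B| = degin A x - degin A y & equated 2 (induced B).
Proof.
move=> xA yA xy dyx ymax.
have [E sED cE] := subset_of_card (card_private_nbrs xA yA).
have sEx : E \subset nbrs A x.
  by apply: subset_trans sED _; rewrite (subset_trans (subsetDl _ _)) ?subsetDl.
have sEA : E \subset A.
  by apply: subset_trans sEx _; apply/subsetP=> z; rewrite inE => /andP[].
exists (A :\: E); first by rewrite setDDr setDv set0U (setIidPr sEA).
have sBA := subsetDl A E.
have nbrsD z : nbrs (A :\: E) z = nbrs A z :\: E.
  by apply/setP=> w; rewrite !inE -!andbA; do !bool_congr.
have dx : degin (A :\: E) x = degin A y.
  by rewrite /degin nbrsD cardsDS // cE subKn.
have dy : degin (A :\: E) y = degin A y.
  rewrite /degin nbrsD; congr #|pred_of_set _|; apply/setDidPl.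
  rewrite disjoint_sym; apply/pred0P => z /=; apply/negP=> /andP[/(subsetP sED)].
  by rewrite inE => /andP[/negPf->].
have xB : x \in A :\: E.
  by rewrite inE xA andbT; apply/negP=> /(subsetP sEx); rewrite inE adj_irr andbF.
have yB : y \in A :\: E.
  by rewrite inE yA andbT; apply/negP=> /(subsetP sED); rewrite !inE eqxx andbF.
apply: (equated2 xB yB xy); first by rewrite dx dy.
move=> z zB; rewrite dx; have [->|zx] := eqVneq z x; first by rewrite dx.
by apply: leq_trans (deginS z sBA) (ymax z (subsetP sBA z zB) zx).
Qed.

Lemma top_two A : 1 < #|A| -> exists x y,
  [/\ x \in A, y \in A, x != y, degin A y <= degin A x
    & forall z, z \in A -> z != x -> degin A z <= degin A y].
Proof.
move=> A2; have /card_gt0P[x0 x0A] : 0 < #|A| by apply: ltnW.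
case: (arg_maxnP (degin A) x0A) => x xA0 xmax; have {xA0}xA : x \in A := xA0.
have /card_gt0P[y0 y0A] : 0 < #|A :\ x|.
  by move: A2; rewrite (cardsD1 x A) xA.
case: (arg_maxnP (degin A) y0A) => y /setD1P[yx yA] ymax.
exists x, y; split; rewrite 1?eq_sym //; first exact: xmax.
by move=> z zA zx; apply: ymax; apply/setD1P.
Qed.

(** Either levelling the two top degrees is cheap, or the gap between them is
    more than [t] and removing the top vertex brings the maximum degree down
    to the previous triangular number. *)
Lemma equate2 t A : (forall x, x \in A -> degin A x <= 'C(t.+2, 2)) ->
  exists2 B, #|A :\: B| <= t & equated 2 (induced B).
Proof.
elim: t A => [|t IH] A Ad; have [A2|] := ltnP #|A| 2.
1,3: by exists A; rewrite ?setDv ?cards0 // equated_small.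
all: case/top_two=> [x [y [xA yA xy dyx ymax]]].
all: have [B cB eB] := level_top_degrees xA yA xy dyx ymax.
  (* Maximum degree at most 1: a neighbour of x has the same degree as x. *)
  exists B => //; rewrite cB leqNgt subn_gt0; apply/negP=> {}dyx.
  have /card_gt0P[z] : 0 < #|nbrs A x| by apply: leq_ltn_trans dyx.
  rewrite inE => /andP[zA xz].
  have zx : z != x by apply: contraTneq xz => ->; rewrite adj_irr.
  have : 0 < degin A z by apply/card_gt0P; exists x; rewrite inE xA adj_sym.
  have := ymax z zA zx; have := Ad x xA; rewrite binn; lia.
have [le|gt] := leqP (degin A x - degin A y) t.+1; first by exists B; rewrite ?cB.
have [|C cC eC] := IH (A :\ x); last by exists C; first exact: card_del_trans cC.
move=> z /setD1P[zx zA]; apply: leq_trans (deginS z (subsetDl _ _)) _.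
by have := ymax z zA zx; have := Ad x xA; rewrite binS bin1; lia.
Qed.
End UpperBounds.

(** * Extremal graphs *)

Section StarForest.
Variables (I : finType) (N : nat) (a : I -> nat).

(** In copy [i], [None] is the centre and [Some j] is a leaf when [j < a i] and
    an isolated vertex otherwise. Giving all the copies the same vertex set
    avoids a dependent vertex type, and the isolated vertices serve to keep the
    order of the graph large. *)
Definition star_adj : rel (I * option 'I_N) := fun u v =>
  (u.1 == v.1) &&
  match u.2, v.2 with
  | None, Some j | Some j, None => j < a u.1
  | _, _ => false
  end.

Lemma star_adj_sym : symmetric star_adj.
Proof.
move=> [i p] [j q]; rewrite /star_adj /= eq_sym.
by case: eqP => //= ->; case: p q => [p|] [q|].
Qed.

Lemma star_adj_irr : irreflexive star_adj.
Proof. by move=> [i [p|]]; rewrite /star_adj eqxx. Qed.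

Definition star_forest := SGraph star_adj_sym star_adj_irr.

Implicit Types A S : {set star_forest}.

Definition centre (i : I) : star_forest := (i, None).

Lemma centre_inj : injective centre.
Proof. by move=> i j []. Qed.

Lemma degin_leaf A i p : degin A (i, Some p) <= 1.
Proof.
rewrite -(cards1 (centre i)); apply/subset_leq_card/subsetP=> -[j q].
rewrite !inE /= /star_adj /= => /and3P[_ /eqP <-].
by case: q => [//|]; rewrite eqxx.
Qed.

Hypothesis aN : forall i, a i <= N.

Lemma degin_centre i : degin setT (centre i) = a i.
Proof.
pose leaf (p : 'I_(a i)) : star_forest := (i, Some (widen_ord (aN i) p)).
have leaf_inj : injective leaf by move=> p q [/val_inj].
rewrite -[RHS]card_ord -(card_imset _ leaf_inj).
apply: eq_card => -[j q]; rewrite !inE /= /star_adj /=; apply/andP/imsetP.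
  case: q => [q|] [/eqP<-] // qi.
  by exists (Ordinal qi) => //; congr (_, Some _); apply: val_inj.
by case=> p _ [-> ->]; rewrite eqxx /=.
Qed.

Lemma degin_centre_le A i : degin A (centre i) <= a i.
Proof. by rewrite -degin_centre deginS // subsetT. Qed.

Lemma maxdeg_star_forest D : 0 < D -> (forall i, a i <= D) ->
  maxdeg star_forest <= D.
Proof.
move=> D0 aD; rewrite maxdegE; apply/bigmax_leqP => -[i [p|]] _.
  by apply: leq_trans (degin_leaf _ _ _) D0.
by rewrite degin_centre.
Qed.

End StarForest.

Definition matching m k : sgraph :=
  star_forest k (fun _ : 'I_m => 1).

(** Fewer than [m] deletions leave some copy intact: its edge makes the maximum
    degree 1, which too few vertices can attain, while its isolated vertices
    alone keep the order above [k]. *)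
Lemma deletable_matching m k (S : {set matching m k}) :
  0 < k -> m.*2 < k -> deletable k S -> m <= #|S|.
Proof.
move=> k0 mk; rewrite /deletable; apply: contraTT; rewrite -ltnNge => Sm.
have /subsetPn[i _ iS] : ~~ ([set: 'I_m] \subset [set u.1 | u in S]).
  apply/negP=> /subset_leq_card; rewrite cardsT card_ord leqNgt => /negP[].
  exact: leq_ltn_trans (leq_imset_card _ _) Sm.
have iB (q : option 'I_k) : (i, q) \in ~: S.
  by rewrite inE; apply: contra iS => iqS; apply/imsetP; exists (i, q).
have dle u : u \in ~: S -> degin (~: S) u <= 1.
  by case: u => j [p|] _; [apply: degin_leaf | apply: degin_centre_le].
have di : degin (~: S) (i, None) = 1.
  apply/eqP; rewrite eqn_leq dle //=; apply/card_gt0P.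
  by exists (i, Some (Ordinal k0)); rewrite inE iB /= /star_adj eqxx.
rewrite (equated_induced k (iB None) di dle) negb_or -ltnNge -leqNgt.
apply/andP; split.
  apply: leq_ltn_trans mk.
  (* Only centres and first leaves can have degree 1. *)
  pose f (jb : 'I_m * bool) : matching m k :=
    (jb.1, if jb.2 then Some (Ordinal k0) else None).
  have -> : m.*2 = #|{: 'I_m * bool}| by rewrite card_prod card_ord card_bool muln2.
  apply: leq_trans (leq_imset_card f _).
  apply/subset_leq_card/subsetP=> -[j [p|]]; rewrite inE => /andP[_ /eqP d1];
    apply/imsetP; last by exists (j, false).
  exists (j, true) => //; congr (_, Some _); apply: val_inj => /=.
  have /card_gt0P[[j' [q|]]] : 0 < degin (~: S) (j, Some p) by rewrite d1.
    by rewrite inE /= /star_adj /= !andbF.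
  by rewrite inE /= /star_adj /= => /and3P[_ _]; case: (nat_of_ord p).
have : #|[set (i, q) | q : option 'I_k] : {set matching m k}| = k.+1.
  by rewrite card_imset ?card_option ?card_ord // => q r [].
move=> card_i; apply: ltnW; rewrite -card_i.
by apply/subset_leq_card/subsetP=> u /imsetP[q _ ->].
Qed.

(** Consecutive sizes differ by [i + 1], just above the number [i] of leaves
    that star [i] can lose once all the larger centres are gone. *)
Definition triangular_stars m : sgraph :=
  star_forest 'C(m.+1, 2).+1 (fun i : 'I_m => 'C(i.+2, 2).+1).

(** The largest surviving centre is the only vertex of maximum degree. *)
Lemma deletable_triangular_stars m (S : {set triangular_stars m}) :
  deletable 2 S -> m <= #|S|.
Proof.
pose a (i : 'I_m) := 'C(i.+2, 2).+1; pose N := 'C(m.+1, 2).+1.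
have aN i : a i <= N by rewrite ltnS leq_bin2l // ltnS.
pose c : 'I_m -> triangular_stars m := @centre _ N a.
rewrite /deletable; apply: contraTT; rewrite -ltnNge => Sm.
have /subsetPn[_ /imsetP[i0 _ ->] i0S] : ~~ (c @: 'I_m \subset S).
  apply/negP=> /subset_leq_card; rewrite card_imset ?card_ord; last exact: centre_inj.
  by rewrite leqNgt Sm.
case: (@arg_maxnP _ i0 (fun i => c i \notin S) val i0S) => i iS imax.
pose L := nbrs setT (c i).
have dS A : degin A (c i) <= #|A|.
  by apply/subset_leq_card/subsetP=> u; rewrite inE => /andP[].
(* The deleted leaves of star i compete for the same m - 1 deletions with the
   m - (i + 1) larger centres, all of which are deleted. *)
have LS : #|L :&: S| <= i.
  pose C := c @: ~: [set j : 'I_m | j <= i].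
  have le_i : #|[set j : 'I_m | j <= i]| <= i.+1.
    rewrite -[leqRHS]card_ord.
    apply: leq_trans (leq_imset_card (widen_ord (ltn_ord i)) _).
    apply/subset_leq_card/subsetP=> j; rewrite inE -ltnS => ji.
    by apply/imsetP; exists (Ordinal ji) => //; apply: val_inj.
  have cC : #|C| = m - #|[set j : 'I_m | j <= i]|.
    have c_inj : injective c by apply: centre_inj.
    by rewrite (card_imset _ c_inj) [LHS]cardsCs setCK card_ord.
  have sub : (L :&: S) :|: C \subset S.
    rewrite subUset subsetIr; apply/subsetP=> _ /imsetP[j ji ->].
    by apply: contraTT ji => /imax; rewrite !inE negbK.
  have dis : (L :&: S) :&: C = set0.
    apply/setP=> u; rewrite !inE; apply/negP=> /andP[/andP[Lu _] /imsetP[j _ uj]].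
    by move: Lu; rewrite uj /= /star_adj andbF.
  have := subset_leq_card sub; rewrite cardsU dis cards0 cC; lia.
(* Here 'C(i.+1, 2).+1 is the size of the next smaller star or, for i = 0,
   the degree 1 of a leaf. *)
have dci : 'C(i.+1, 2).+1 < degin (~: S) (c i).
  have -> : degin (~: S) (c i) = a i - #|L :&: S|.
    rewrite -[a i](degin_centre aN) -cardsD; apply: eq_card => u.
    by rewrite !inE.
  by rewrite /a (binS i.+1) bin1; lia.
have lt_ci u : u \in ~: S -> u != c i -> degin (~: S) u < degin (~: S) (c i).
  case: u => j [p|] uS uci; apply: leq_ltn_trans dci.
    by apply: leq_trans (degin_leaf _ _ _) _.
  apply: leq_trans (degin_centre_le aN _ _) _; rewrite ltnS leq_bin2l // !ltnS.
  rewrite inE in uS; have ji : j <= i := imax j uS; rewrite ltn_neqAle ji andbT.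
  by apply: contra uci => /eqP /val_inj ->.
have ciS : c i \in ~: S by rewrite inE.
rewrite (equated_induced 2 ciS (erefl _)) => [|u uS]; last first.
  by have [->//|uci] := eqVneq u (c i); apply/ltnW/lt_ci.
rewrite negb_or -ltnNge -leqNgt ltnS; apply/andP; split; last first.
  by apply: leq_trans (dS _); apply: leq_ltn_trans dci; rewrite ltnS.
rewrite -(cards1 (c i)); apply/subset_leq_card/subsetP=> u.
rewrite !inE => /andP[uS /eqP du]; apply/negPn/negP=> uci.
by have := lt_ci u; rewrite inE uS uci du ltnn => /(_ isT isT).
Qed.

(** * The values of g *)

Lemma degin_maxdeg (G : sgraph) (A : {set G}) x : degin A x <= maxdeg G.
Proof.
by rewrite maxdegE; apply: leq_trans (leq_bigmax x); apply/deginS/subsetT.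
Qed.

Lemma is_g0 k : is_g 0 k 0.
Proof.
suff ub (G : sgraph) : maxdeg G <= 0 -> fk k G <= 0.
  split=> //; exists (star_forest 0 (fun _ : 'I_0 => 0)).
  have md : maxdeg (star_forest 0 (fun _ : 'I_0 => 0)) <= 0.
    by apply/bigmax_leqP => -[[]].
  by split=> //; apply/eqP; rewrite -leqn0 ub.
move=> G0; apply: fk_le_induced; exists setT; first by rewrite setDv cards0.
apply: equated_edgeless => x _; apply/eqP.
by rewrite -leqn0 (leq_trans (degin_maxdeg _ _)).
Qed.

Lemma is_g1 k : 0 < k -> is_g 1 k (k.-1)./2.
Proof.
move=> k0; set t := (k.-1)./2.
have ub (G : sgraph) : maxdeg G <= 1 -> fk k G <= t.
  move=> G1; apply: fk_le_induced.
  have A1 x : x \in [set: G] -> degin setT x <= 1.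
    by move=> _; apply: leq_trans (degin_maxdeg _ _) G1.
  have [kD|Dk] := leqP k #|[set x in [set: G] | degin setT x == 1]|.
    exists setT; first by rewrite setDv cards0.
    have /card_gt0P[x] : 0 < #|[set x in [set: G] | degin setT x == 1]|.
      exact: leq_trans kD.
    rewrite inE => /andP[xT /eqP dx].
    by rewrite (equated_induced k xT dx A1) kD.
  have [|B cB B0] := edgeless_matching (t := t) A1; first by lia.
  by exists B => //; apply: equated_edgeless.
split=> //; exists (matching t k).
have md : maxdeg (matching t k) <= 1 by apply: maxdeg_star_forest.
split=> //; apply/eqP; rewrite eqn_leq ub //=; apply: fk_ge => S.
by apply: deletable_matching => //; lia.
Qed.

Lemma is_g2 D m : 'C(m.+1, 2) < D <= 'C(m.+2, 2) -> is_g D 2 m.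
Proof.
case/andP=> lo hi.
have ub (G : sgraph) : maxdeg G <= D -> fk 2 G <= m.
  move=> GD; apply: fk_le_induced; apply: equate2 => x _.
  exact: leq_trans (degin_maxdeg _ _) (leq_trans GD hi).
have aN (i : 'I_m) : 'C(i.+2, 2).+1 <= 'C(m.+1, 2).+1.
  by rewrite ltnS leq_bin2l // ltnS.
split=> //; exists (triangular_stars m).
have md : maxdeg (triangular_stars m) <= D.
  apply: maxdeg_star_forest => // [|i]; first exact: leq_ltn_trans lo.
  exact: leq_trans (aN i) lo.
split=> //; apply/eqP; rewrite eqn_leq ub //=; apply: fk_ge => S.
exact: deletable_triangular_stars.
Qed.

Lemma triangular_bracket D : 0 < D ->
  exists m, 'C(m.+1, 2) < D <= 'C(m.+2, 2).
Proof.
move=> D0; have exm : exists m, D <= 'C(m.+2, 2).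
  by exists D; rewrite binS bin1; lia.
case: (ex_minnP exm) => m hi minm; exists m; rewrite hi andbT.
case: m minm {hi} => [|m] minm //; rewrite ltnNge.
by apply/negP=> /minm; rewrite ltnn.
Qed.

(** By the identity (2n+1)^2 = 8 T(n+1) + 1, the bracket says that the square
    root lies in the interval from 2m+1 (excluded) to 2m+3 (included). *)
Lemma ceil_triangular (R : realType) D m : 'C(m.+1, 2) < D <= 'C(m.+2, 2) ->
  Posz m = Num.ceil ((- 3 + Num.sqrt (8 * D%:R + 1)) / 2 : R)%R.
Proof.
have odd_sq n : (2 * n + 1) ^ 2 = 8 * 'C(n.+1, 2) + 1.
  elim: n => [//|n IH]; move: IH; rewrite (binS n.+1) bin1; nia.
case/andP=> lo hi; apply/esym/eqP; rewrite ceil_eq.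
have loR : ((2 * m%:R + 1) ^+ 2 < 8 * D%:R + 1 :> R)%R.
  have : (2 * m + 1) ^ 2 < 8 * D + 1 by rewrite odd_sq; lia.
  by rewrite -(ltr_nat R) natrX (natrD _ (2 * m)) (natrD _ (8 * D)) !natrM.
have hiR : (8 * D%:R + 1 <= (2 * m%:R + 3) ^+ 2 :> R)%R.
  have : 8 * D + 1 <= (2 * m + 3) ^ 2.
    by rewrite (_ : 2 * m + 3 = 2 * m.+1 + 1) ?odd_sq; lia.
  by rewrite -(ler_nat R) natrX (natrD _ (2 * m)) (natrD _ (8 * D)) !natrM.
have m0 : (0 <= m%:R :> R)%R by apply: ler0n.
have D0 : (0 <= 8 * D%:R + 1 :> R)%R by have := ler0n R D; lra.
move: (sqr_sqrtr D0) (sqrtr_ge0 (8 * D%:R + 1 : R)%R).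
set s := Num.sqrt _ => s2 s0.
have loS : (2 * m%:R + 1 < s)%R by nra.
have hiS : (s <= 2 * m%:R + 3)%R by nra.
by rewrite intrB -!pmulrn; apply/andP; split; lra.
Qed.

Theorem proposition4p2 (R : realType) (Delta k : nat) (hk : 2 <= k) :
  is_g 0 k 0 /\
  is_g 1 k ((k - 1) %/ 2) /\
  (1 <= Delta ->
   exists m : nat, is_g Delta 2 m /\
     Posz m = Num.ceil ((- 3 + Num.sqrt (8 * Delta%:R + 1)) / 2 : R)%R).
Proof.
split; first exact: is_g0.
split; first by rewrite subn1 divn2; apply: is_g1; apply: ltnW.
case/triangular_bracket=> m mD; exists m.
by split; [apply: is_g2 | apply: ceil_triangular].
Qed.
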